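(* Let $X$ be a compact Hausdorff space which is homogeneous and has countable tightness. Then $|X|\leq 2^{\aleph_0}$.
   Context: A space $X$ has countable tightness (written $t(X)=\aleph_0$) if whenever $A\subseteq X$ and $x\in\overline{A}$, there is a countable $B\subseteq A$ with $x\in\overline{B}$. A space $X$ is homogeneous if for every $x,y\in X$ there is a homeomorphism $f$ of $X$ onto $X$ with $f(x)=y$. The theorem is a theorem of ZFC. *)

(* Defs.v *)
From mathcomp Require Import all_boot all_classical topology.

Set Implicit Arguments.
Unset Strict Implicit.
Unset Printing Implicit Defensive.

Local Open Scope classical_set_scope.

Definition homeomorphism (X Y : topologicalType) (f : X -> Y) : Prop :=
  continuous f /\
  exists g : Y -> X, [/\ continuous g, cancel f g & cancel g f].

Definition homogeneous (X : topologicalType) : Prop :=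
  forall x y : X, exists f : X -> X, homeomorphism f /\ f x = y.

Definition countably_tight (X : topologicalType) : Prop :=
  forall (A : set X) (x : X), closure A x ->
    exists B : set X, [/\ B `<=` A, countable B & closure B x].

(* Main.v *)
(* A free sequence of length omega1 cannot exist in a countably tight compact
   space. From this, on one hand some nonempty G_delta set lies in the closure
   of a countable set, so that by homogeneity every point lies in such a set; on
   the other hand, every point has a countable local pi-base.

   A cover by G_delta sets has a subcover of size continuum (Pytkeev), by a
   closing-off argument: close a set [A] under picking, for finitely many
   neighbourhoods of chosen G_delta sets traced on countable subsets of [A], a
   point outside their union. Transfinite iteration is avoided by indexing the
   picked points by well-founded countably branching trees, of which there are
   continuum many. Hence the space has a dense subset of size continuum.

   Finally, translating a countable local pi-base at [p] to each point [q] by a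
   homeomorphism and choosing a point of the dense set in each translate maps
   the space injectively to countable sequences in the dense set. *)
Require Import Defs.
From mathcomp Require Import finmap all_boot all_classical topology.
From mathcomp Require Import wochoice.

Local Open Scope classical_set_scope.

(** * Types of size at most the continuum *)

Lemma continuum_inj (T S : Type) (f : T -> S) : injective f ->
  ([set: S] #<= [set: set nat])%card -> ([set: T] #<= [set: set nat])%card.
Proof.
move=> finj /pcard_injP[g ginj]; apply/pcard_injP; exists (g \o f).
by move=> x y _ _ /= /(ginj _ _ (in_setT _) (in_setT _)) /finj.
Qed.

Lemma continuum_set (K : countType) : ([set: set K] #<= [set: set nat])%card.
Proof.
apply/pcard_injP; exists (fun A => pickle @` A) => A B _ _ eqAB.
apply/funext => k; have pinj := pcan_inj (@pickleK K).
by rewrite -(image_inj pinj (A := A)) eqAB image_inj.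
Qed.

Lemma continuum_fun (K : countType) (T : Type) :
  ([set: T] #<= [set: set nat])%card ->
  ([set: K -> T] #<= [set: set nat])%card.
Proof.
move=> /pcard_injP[f finj].
apply: (@continuum_inj _ _ (fun h => [set z : K * nat | f (h z.1) z.2])
  _ (continuum_set _)) => h1 h2 eqh.
apply/funext => k; apply: finj; rewrite ?inE //.
by apply/funext => n; have /(congr1 (@^~ (k, n))) := eqh.
Qed.

Lemma continuum_count (K : countType) : ([set: K] #<= [set: set nat])%card.
Proof.
apply: (@continuum_inj _ _ set1 _ (continuum_set K)) => x y exy.
by have : [set x] x by []; rewrite exy.
Qed.

Lemma continuum_prod (T S : Type) : ([set: T] #<= [set: set nat])%card ->
  ([set: S] #<= [set: set nat])%card ->
  ([set: T * S] #<= [set: set nat])%card.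
Proof.
move=> /pcard_injP[f finj] /pcard_injP[g ginj].
apply: (@continuum_inj _ _ (fun z (b : bool) => if b then f z.1 else g z.2)
  _ (@continuum_fun bool _ (continuum_set nat))) => -[x y] [x' y'] /= e.
have /finj -> := congr1 (@^~ true) e; rewrite ?inE //.
by have /ginj -> := congr1 (@^~ false) e; rewrite ?inE.
Qed.

Lemma continuum_seq (T : Type) : ([set: T] #<= [set: set nat])%card ->
  ([set: seq T] #<= [set: set nat])%card.
Proof.
move=> /pcard_injP[f finj].
apply: (@continuum_inj _ _ (fun s => (size s, nth set0 (map f s)))); last first.
  apply: continuum_prod; first exact: continuum_count.
  exact/continuum_fun/continuum_set.
move=> s t [est enth]; apply: (@inj_map _ _ f).
  by move=> x y; apply: finj; rewrite inE.
by apply: (@eq_from_nth _ set0); rewrite ?size_map // => i _; rewrite enth.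
Qed.

Inductive tree (K L : Type) := Leaf | Node of L & (K -> tree K L).
Arguments Leaf {K L}.
Arguments Node {K L}.

(* A tree is determined by the label found at the end of each finite branch. *)
Fixpoint tree_label {K L} (t : tree K L) (p : seq K) : option L :=
  if t isn't Node l c then None else
  if p is k :: p' then tree_label (c k) p' else Some l.

Lemma tree_label_inj K L : injective (@tree_label K L).
Proof.
elim=> [|l c IH] [|l' c'] e //; try by have := congr1 (@^~ [::]) e.
have [->] : Some l = Some l' by exact: (congr1 (@^~ [::]) e).
congr Node; apply/funext => k; apply: IH; apply/funext => p.
exact: (congr1 (@^~ (k :: p)) e).
Qed.

Lemma continuum_tree (K : countType) (L : Type) :
  ([set: L] #<= [set: set nat])%card ->
  ([set: tree K L] #<= [set: set nat])%card.
Proof.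
move=> /continuum_seq cL.
apply: (@continuum_inj _ _ _ (@tree_label_inj K L)); apply: continuum_fun.
by apply: (@continuum_inj _ _ seq_of_opt) cL => -[x|] [y|] // [->].
Qed.

(** The default [t0] pads the enumeration, so that empty and finite sets are covered too. *)
Lemma countable_sub_range {T : Type} {t0 : T} {A : set T} : countable A ->
  exists e : nat -> T, A `<=` range e /\ range e `<=` t0 |` A.
Proof.
move=> /pcard_injP[f finj].
pose e n := if pselect (exists x, A x /\ f x = n) is left h
  then projT1 (cid h) else t0.
exists e; split => [x Ax|_ [n _ <-]].
  exists (f x) => //; rewrite /e; case: pselect => [h|[]]; last by exists x.
  by case: cid => y /= [Ay /finj]; apply; rewrite inE.
rewrite /e; case: pselect => [h|_]; last by left.
by case: cid => y /= []; right.
Qed.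

(** * The ordinal omega1 and recursion along it *)

Lemma uncountable_set_nat : ~ countable [set: set nat].
Proof.
move=> /pcard_injP[f finj].
pose D := [set n | exists A : set nat, f A = n /\ ~ A n].
have nD : ~ D (f D).
  move=> /[dup] DD [A [e nA]]; apply: nA.
  by have -> : A = D by apply: finj => //; rewrite inE.
by apply: (nD); exists D.
Qed.

Definition is_omega1 {W : Type} (lt : W -> W -> Prop) : Prop :=
  [/\ well_founded lt,
      forall a b c, lt a b -> lt b c -> lt a c,
      forall a b, [\/ lt a b, a = b | lt b a],
      forall a, countable [set b | lt b a] &
      forall B : set W, countable B -> exists a, forall b, B b -> lt b a].

Lemma ex_omega1 :
  exists (W : choiceType) (lt : W -> W -> Prop), is_omega1 lt.
Proof.
have [R woR] := well_ordering_principle (set nat).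
have minR (A : set (set nat)) x : A x ->
    exists2 m, A m & forall y, A y -> R m y.
  move=> Ax; have [|m [[Am mA] _]] := woR (mem A).
    by exists x; exact: mem_set.
  exists m; first exact: set_mem.
  by move=> y Ay; apply: mA; exact: mem_set.
(* [R] is only known to give every nonempty set a unique minimum; sets of one, two and three points
   yield the order axioms. *)
have Ranti x y : R x y -> R y x -> x = y.
  move=> Rxy Ryx; have Rr z : R z z.
    by have [_ -> zR] := minR [set z] z erefl; exact: zR.
  have [|m [_ mU]] := woR (mem [set x; y]).
    by exists x; apply/mem_set; left.
  have mx : m = x.
    by apply: mU; split=> [|z /set_mem [->|->] //]; apply/mem_set; left.
  have my : m = y.
    by apply: mU; split=> [|z /set_mem [->|->] //]; apply/mem_set; right.
  by rewrite -mx.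
have Rtot x y : R x y \/ R y x.
  have [m [->|->] mR] := minR [set x; y] x (or_introl erefl).
    by left; apply: mR; right.
  by right; apply: mR; left.
have Rtrans x y z : R x y -> R y z -> R x z.
  move=> Rxy Ryz.
  have [m [[->|->]|->] mR] :=
    minR [set x; y; z] x (or_introl (or_introl erefl)).
  - by apply: mR; right.
  - by rewrite (Ranti x y) //; apply: mR; left; left.
  - by rewrite -(Ranti y z) //; apply: mR; left; right.
(* The initial segment of the points with countably many predecessors. *)
pose P (x : set nat) := `[< countable [set y | R y x] >].
pose W : choiceType := {x : set nat | P x}.
pose lt (a b : W) := val a <> val b /\ R (val a) (val b).
have cle (a : W) : countable [set b : W | R (val b) (val a)].
  have /asboolP/pcard_injP[f finj] := valP a.
  apply/pcard_injP; exists (f \o val) => b c; rewrite !inE => Rb Rc /= e.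
  by apply/val_inj/finj; rewrite ?inE.
exists W, lt; split.
- move=> a; apply: contrapT => na.
  have [m [b [bm nb]] mR] :=
    minR [set x | exists b : W, val b = x /\ ~ Acc lt b]
    _ (ex_intro _ a (conj erefl na)).
  rewrite -bm in mR; apply: nb; constructor=> c [cb Rcb].
  by apply: contrapT => nc; apply: cb; apply: Ranti => //; apply: mR; exists c.
- move=> a b c [ab Rab] [bc Rbc]; split; last exact: Rtrans Rab Rbc.
  by move=> ac; apply: bc; apply: Ranti => //; rewrite -ac.
- move=> a b; have [->|ab] := pselect (a = b); first by constructor 2.
  have vab : val a <> val b by move=> /val_inj.
  have [Rab|Rba] := Rtot (val a) (val b).
    by constructor 1.
  by constructor 3; split=> //; apply: nesym.
- by move=> a; apply: sub_countable (cle a); apply: subset_card_le => b [].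
(* An unbounded countable [B] would make [W] countable; the least point outside [P] would then have
   countably many predecessors and lie in [P]. *)
- move=> B cB; apply: contrapT => nB.
  have cW : countable [set: W].
    have : countable (\bigcup_(b in B) [set c : W | R (val c) (val b)]).
      exact: bigcup_countable.
    apply: sub_countable; apply: subset_card_le => a _.
    have /existsNP[b /not_implyP[Bb nba]] := (forallNP _).2 nB a.
    exists b => //=; apply: contrapT => nab; apply: nba.
    have [/nab //|Rba] := Rtot (val a) (val b); split=> // e.
    by apply: nab; rewrite -e; case: (Rtot (val b) (val b)).
  have cP : countable [set x | P x].
    have /pcard_injP[f finj] := cW.
    apply/pcard_injP; exists (fun x => if insub x is Some a then f a else 0%N).
    move=> x y; rewrite !inE => Px Py; rewrite !insubT.
    by move=> /finj -/(_ (in_setT _) (in_setT _)) [].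
  have [x nPx] : exists x, ~ P x.
    apply/existsNP => allP; apply: uncountable_set_nat.
    by apply: sub_countable cP; apply: subset_card_le => x _; exact: allP.
  have [m nPm mR] := minR [set x | ~ P x] x nPx.
  apply: nPm; apply/asboolP.
  have : countable ([set x | P x] `|` [set m]).
    rewrite -bigcup2E; apply: bigcup_countable => // -[|[|i]] _ /=.
    - exact: cP.
    - exact: countable1.
    - exact: countable0.
  apply: sub_countable; apply: subset_card_le => y /= Rym.
  have [Py|nPy] := pselect (P y); [by left|right].
  by apply: Ranti => //; exact: mR.
Qed.

Section wo_recursion.
Context {W : Type} {lt : W -> W -> Prop} (ltwf : well_founded lt).
Context {Y : Type} (phi : set Y -> Y).

Lemma wo_recursion : exists f : W -> Y,
  forall a, f a = phi (f @` [set b | lt b a]).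
Proof.
exists (Fix ltwf (fun _ => Y)
  (fun a rec => phi [set z | exists b (h : lt b a), z = rec b h])) => a.
rewrite Fix_eq => [|x f g fg]; last first.
  by congr phi; apply/seteqP; split=> _ [b [h ->]]; exists b, h.
congr phi; apply/seteqP; split=> z /=.
  by move=> [b [h ->]]; exists b.
by move=> [b h <-]; exists b, h.
Qed.

End wo_recursion.

(** * Compactness, regularity and free sequences *)

Lemma compact_fip {X : topologicalType} {I : choiceType} {D : set I}
    {K : I -> set X} : compact [set: X] ->
  (forall i, D i -> closed (K i)) ->
  (forall l : seq I, (forall i, i \in l -> D i) ->
     exists x, forall i, i \in l -> K i x) ->
  exists x, forall i, D i -> K i x.
Proof.
move=> cX Kcl fip.
pose B (l : seq I) := [set x | forall i, i \in l -> K i x].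
pose F := filter_from [set l | forall i, i \in l -> D i] B.
have FF : ProperFilter F.
  apply: filter_from_proper => [|l /fip [x Hx]]; last by exists x.
  apply: filter_from_filter; first by exists [::].
  move=> l l' Dl Dl'; exists (l ++ l').
    by move=> i; rewrite mem_cat => /orP[/Dl|/Dl'].
  by move=> x Hx; split=> i il; apply: Hx; rewrite mem_cat il ?orbT.
have [x [_ clx]] := cX F FF filterT.
exists x => i Di; apply: (Kcl i Di) => V Vx.
apply: clx => //; exists [:: i] => [j|y]; first by rewrite inE => /eqP ->.
by apply; rewrite inE.
Qed.

Section compact_tight.
Context {X : topologicalType}.
Hypothesis cX : compact [set: X].
Hypothesis hX : hausdorff_space X.

Lemma shrink_open {x : X} {O : set X} : open O -> O x ->
  exists V, [/\ open V, V x & closure V `<=` O].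
Proof.
move=> oO Ox.
have rx : {for x, regular_space X} by exact: compact_regular hX cX filterT.
have [V Vx VO] := rx O (open_nbhs_nbhs (conj oO Ox)).
exists V°; split; first exact: open_interior.
  exact: Vx.
apply: subset_trans VO; by apply: closureS; exact: interior_subset.
Qed.

Lemma nested_opens {x : X} {O : nat -> set X} :
  (forall n, open (O n)) -> (forall n, O n x) ->
  exists U : nat -> set X, [/\ forall n, open (U n), forall n, U n x,
    forall n, closure (U n.+1) `<=` U n & forall n, U n `<=` O n].
Proof.
move=> oO Ox.
have ex (V : set X) n : open V -> V x ->
    exists V', [/\ open V', V' x & closure V' `<=` V `&` O n].
  by move=> oV Vx; apply: shrink_open => //; exact: openI.
pose next n V := xget setT
  [set V' | [/\ open V', V' x & closure V' `<=` V `&` O n]].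
pose U := fix U n := if n is m.+1 then next n (U m) else next 0%N setT.
have Uox n : open (U n) /\ U n x.
  elim: n => [|n [oU Ux]].
    by have [] := xgetPex setT (ex setT 0%N openT I).
  by have [] := xgetPex setT (ex _ n.+1 oU Ux).
have UU n : closure (U n.+1) `<=` U n `&` O n.+1.
  by have [oU Ux] := Uox n; have [] := xgetPex setT (ex _ n.+1 oU Ux).
exists U; split => [n|n|n|[|n]]; try by have [] := Uox n.
- by move=> y /UU [].
- have [_ _ h] := xgetPex setT (ex setT 0%N openT I).
  by move=> y /subset_closure /h [].
- by move=> y /subset_closure /UU [].
Qed.

End compact_tight.

Section omega1.
Context {W : choiceType} {lt : W -> W -> Prop}.
Hypothesis ltW : is_omega1 lt.

Lemma omega1_irr a : ~ lt a a.
Proof.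
have [wf _ _ _ _] := ltW.
by elim: (wf a) => b _ IH bb; exact: (IH b).
Qed.

Lemma omega1_max (a0 : W) (l : seq W) :
  exists2 m, m \in a0 :: l & forall i, i \in a0 :: l -> i = m \/ lt i m.
Proof.
have [_ tr tot _ _] := ltW.
elim: l a0 => [|a l IH] a0.
  by exists a0 => [|i]; rewrite inE ?eqxx // => /eqP ->; left.
have [m ml mmax] := IH a.
have [am|->|ma] := tot a0 m.
- exists m => [|i]; first by rewrite inE ml orbT.
  by rewrite inE => /orP[/eqP ->|/mmax //]; right.
- by exists m => [|i]; rewrite inE ?eqxx // => /orP[/eqP ->|/mmax //]; left.
- exists a0 => [|i]; rewrite inE ?eqxx // => /orP[/eqP ->|/mmax]; first by left.
  by move=> [->|im]; right => //; exact: tr im ma.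
Qed.

(** By compactness some [p] is in the closure of every tail. Tightness puts [p] in the closure of
    countably many terms, all before some [a]; but [O a] is a neighbourhood of [p] missing them. *)
Lemma no_free_sequence {X : topologicalType} {x : W -> X} {C O : W -> set X} :
  compact [set: X] -> countably_tight X ->
  (forall a, open (O a)) -> (forall a, closure (C a) `<=` O a) ->
  (forall a b, ~ lt b a -> C a (x b)) ->
  (forall a b, lt b a -> ~ O a (x b)) -> False.
Proof.
move=> cX tX oO CO Cx Ox; have [_ tr _ _ bdd] := ltW.
pose K a := closure (x @` [set b | ~ lt b a]).
have [||p Kp] := @compact_fip X W setT K cX.
- by move=> a _; exact: closed_closure.
- move=> [|a0 l] _.
    by have [a _] := bdd set0 (countable0 W); exists (x a).
  have [m _ mmax] := omega1_max a0 l.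
  exists (x m) => i /mmax im; apply: subset_closure; exists m => //= mi.
  by case: im => [im|im]; [move: mi; rewrite im|move: (tr _ _ _ mi im)];
    exact: omega1_irr.
have [a0 _] := bdd set0 (countable0 W).
have [B [Bx cB clB]] : exists B, [/\ B `<=` range x, countable B & closure B p].
  by apply: tX; apply: closureS (Kp a0 I) => _ [b _ <-]; exists b.
have /choice[g gP] : forall y, exists b, B y -> x b = y.
  move=> y; have [/Bx[b _ <-]|nBy] := pselect (B y); first by exists b.
  by exists a0.
have [a aP] : exists a, forall b, (g @` B) b -> lt b a.
  by apply: bdd; apply: sub_countable cB; exact: card_image_le.
have Op : O a p.
  by apply/CO/closureS/(Kp a I) => _ [b nba <-]; exact: Cx.
have [y [By Oy]] := clB (O a) (open_nbhs_nbhs (conj (oO a) Op)).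
by apply: (Ox a (g y)); [apply: aP; exists y|rewrite gP].
Qed.

End omega1.

(** * Small G_delta sets and local pi-bases by omega1-recursion *)

Section countably_tight_compact.
Context {X : topologicalType}.
Hypothesis cX : compact [set: X].
Hypothesis hX : hausdorff_space X.
Hypothesis tX : countably_tight X.

(* Otherwise points [x_a] and nested sequences [U_a] around [x_a], [a] in
   [omega1], can be chosen with [x_a] in all earlier [\bigcap_n U_b n] and with
   [U_a 0] missing all earlier points: a free sequence. *)
Lemma ex_gdelta_sub_closure_countable (x0 : X) :
  exists (p : X) (U : nat -> set X) (s : nat -> X),
    [/\ forall n, open (U n), forall n, U n p,
        forall n, closure (U n.+1) `<=` U n &
        \bigcap_n U n `<=` closure (range s)].
Proof.
apply: contrapT => noG.
have avoid (CC : set (set X)) (S : set X) (x : X) : countable CC ->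
    (forall C, CC C -> open C) -> (forall C, CC C -> C x) -> countable S ->
    exists y, (forall C, CC C -> C y) /\ ~ closure S y.
  move=> cC oC Cx cS.
  have [e [Ce eC]] := @countable_sub_range _ setT _ cC.
  have [s [Ss _]] := @countable_sub_range _ x0 _ cS.
  have [n|n|U [oU Ux UU Ue]] := @nested_opens X cX hX x e.
  - by have [->|/oC //] := eC (e n) (ex_intro2 _ _ n I erefl); exact: openT.
  - by have [->|/Cx //] := eC (e n) (ex_intro2 _ _ n I erefl).
  have /existsNP[y /not_implyP[Uy nsy]] :
      ~ (\bigcap_n U n `<=` closure (range s)).
    by move=> Us; apply: noG; exists x, U, s.
  exists y; split; first by move=> C /Ce[n _ <-]; apply: Ue; exact: Uy.
  by move=> /(closureS Ss).
pose good (s : set (X * (nat -> set X))) (z : X * (nat -> set X)) :=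
  [/\ forall t n, s t -> t.2 n z.1, forall n, open (z.2 n),
      forall n, z.2 n z.1, forall n, closure (z.2 n.+1) `<=` z.2 n &
      forall t, s t -> ~ z.2 0%N t.1].
have ex_good s : countable s -> (forall t n, s t -> open (t.2 n)) ->
    (exists x, forall t n, s t -> t.2 n x) -> exists z, good s z.
  move=> cs os [x sx].
  have [||||y [yC ny]] := avoid (\bigcup_(t in s) range t.2) (fst @` s) x.
  - apply: bigcup_countable => // t _.
    by apply: (@sub_countable _ _ _ [set: nat]); [exact: card_image_le|].
  - by move=> _ [t st [n _ <-]]; exact: os.
  - by move=> _ [t st [n _ <-]]; exact: sx.
  - by apply: sub_countable cs; exact: card_image_le.
  have [n|n|U [oU Uy UU Un]] := @nested_opens X cX hX y
    (fun=> ~` closure (fst @` s)).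
  - exact/closed_openC/closed_closure.
  - exact: ny.
  exists (y, U); split=> //=.
    by move=> t n st; apply: yC; exists t => //; exists n.
  by move=> t st /Un; apply; apply: subset_closure; exists t.
have [W [lt ltW]] := ex_omega1; have [wf tr tot ci bdd] := ltW.
have [f fE] := wo_recursion wf (fun s => xget (x0, fun=> setT) (good s)).
have fgood a : good (f @` [set b | lt b a]) (f a).
  elim: (wf a) => {}a _ IH; rewrite [X in good _ X]fE.
  apply: xgetPex; apply: ex_good.
  - by apply: sub_countable (ci a); exact: card_image_le.
  - by move=> _ n [b /IH[_ + _ _ _] <-].
  (* Finitely many earlier sets share the point chosen at the largest index. Passing to closures
     costs nothing, as each closure lies in the preceding level. *)
  have [|l ll|x Kx] := @compact_fip X W [set b | lt b a]
      (fun b => \bigcap_n closure ((f b).2 n)) cX.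
  - by move=> b _; apply: closed_bigI => n _; exact: closed_closure.
  - case: l ll => [|a0 l] ll; first by exists x0.
    have [m ml mmax] := omega1_max ltW a0 l.
    have [mP _ mU _ _] := IH m (ll m ml).
    exists (f m).1 => i /mmax[->|im] n _; apply: subset_closure => //.
    by apply: mP; exists i.
  - exists x => _ n [b ba <-]; have [_ _ _ + _] := IH b ba.
    by apply; exact: Kx.
(* Level 1 contains the point itself and all later ones, level 0 misses all earlier ones. *)
apply: (@no_free_sequence W lt ltW X (fun a => (f a).1)
  (fun a => (f a).2 1%N) (fun a => (f a).2 0%N)) => //.
- by move=> a; have [] := fgood a.
- by move=> a; have [_ _ _ + _] := fgood a; apply.
- move=> a b nba; have [ab|->|//] := tot a b; last by have [] := fgood b.
  by have [+ _ _ _ _] := fgood b; apply; exists a.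
- by move=> a b ba; have [_ _ _ _] := fgood a; apply; exists b.
Qed.

(* Otherwise neighbourhoods [closure O_a `<=` V_a] of [p], [a] in [omega1], can
   be chosen such that [closure V_a] contains no nonempty open set that is a
   finite intersection of earlier [O_b]s and complements of [closure V_b]s. A
   point in [closure O_b] for [b <= a] and outside [V_b] for [b > a] then exists
   for each [a], and these points form a free sequence. *)
Lemma countable_local_pi_base (p : X) : exists B : nat -> set X,
  [/\ forall n, open (B n), forall n, B n !=set0 &
      forall V, open V -> V p -> exists n, B n `<=` V].
Proof.
apply: contrapT => noB.
have avoid (BB : set (set X)) : countable BB -> exists V,
    [/\ open V, V p & forall B, BB B -> open B -> B !=set0 -> ~ B `<=` V].
  move=> cB; pose BB' := BB `&` [set B | open B /\ B !=set0].
  have cB' : countable BB'.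
    by apply: sub_countable cB; apply: subset_card_le => B [].
  have [e [Be eB]] := @countable_sub_range _ setT _ cB'.
  have eP n : open (e n) /\ e n !=set0.
    have [->|[_ //]] := eB (e n) (ex_intro2 _ _ n I erefl).
    by split; [exact: openT|exists p].
  apply: contrapT => nV; apply: noB; exists e; split=> [n|n|V oV Vp].
  - by have [] := eP n.
  - by have [] := eP n.
  apply: contrapT => /forallNP nBV; apply: nV; exists V; split=> // B BBB oB B0.
  by have [n _ <-] := Be B (conj BBB (conj oB B0)); exact: nBV.
pose gens (s : set (set X * set X)) :=
  snd @` s `|` (fun t : set X * set X => ~` closure t.1) @` s.
pose good (s : set (set X * set X)) (z : set X * set X) :=
  [/\ open z.1, open z.2, z.2 p, closure z.2 `<=` z.1 &
      forall B, finI_from (gens s) id B -> open B -> B !=set0 ->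
        ~ B `<=` closure z.1].
have ex_good s : countable s -> exists z, good s z.
  move=> cs.
  have [|U [oU Up nU]] := avoid (finI_from (gens s) id).
    apply: finI_from_countable; rewrite /gens -bigcup2E.
    apply: bigcup_countable => // -[|[|i]] _ /=; last exact: countable0.
      by apply: sub_countable cs; exact: card_image_le.
    by apply: sub_countable cs; exact: card_image_le.
  have [V [oV Vp VU]] := @shrink_open X cX hX p U oU Up.
  have [O [oO Op OV]] := @shrink_open X cX hX p V oV Vp.
  exists (V, O); split=> // B sB oB B0 BV.
  by apply: (nU B) => //; exact: subset_trans VU.
have [W [lt ltW]] := ex_omega1; have [wf tr tot ci bdd] := ltW.
have [f fE] := wo_recursion wf (fun s => xget (setT, setT) (good s)).
have fgood a : good (f @` [set b | lt b a]) (f a).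
  rewrite [X in good _ X]fE; apply: xgetPex; apply: ex_good.
  by apply: sub_countable (ci a); exact: card_image_le.
pose V a := (f a).1; pose O a := (f a).2.
pose E a b := if pselect (lt a b) then ~` closure (V b) else O b.
have oE a b : open (E a b).
  rewrite /E; case: (pselect (lt a b)) => /= _.
    exact/closed_openC/closed_closure.
  by have [] := fgood b.
(* Induction on the largest index [m] of [L]. If [m] is not above [a], all sets are [O b] and
   contain [p]. Otherwise the remaining sets meet in a nonempty open set built from stages before
   [m], which by choice is not inside [closure (V m)]. *)
have E_fip a g : forall L : seq W, (forall b, b \in L -> lt b g) ->
    exists x, forall b, b \in L -> E a b x.
  elim: (wf g) => {}g _ IH [|b0 L0] Lg; first by exists p.
  have [m mL mmax] := omega1_max ltW b0 L0.
  move: (b0 :: L0) mL mmax Lg => L mL mmax Lg.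
  have [am|nam] := pselect (lt a m); last first.
    exists p => b /mmax bm; rewrite /E; case: (pselect (lt a b)) => [ab|/= _].
      by case: bm => [bm|bm]; exfalso; apply: nam;
        [rewrite -bm|exact: tr ab bm].
    by have [] := fgood b.
  pose L' := [seq b <- L | b != m].
  have L'm b : b \in L' -> lt b m.
    by rewrite mem_filter => /andP[/eqP bm /mmax[]].
  pose B := \bigcap_(b in [set` L']) E a b.
  have [x xB] : B !=set0 by have [x xP] := IH m (Lg m mL) L' L'm; exists x.
  have [oB sB] : open B /\ finI_from (gens (f @` [set b | lt b m])) id B.
    rewrite /B; elim: L' L'm {x xB B} => [|b L' IHL] L'm.
      rewrite set_nil bigcap_set0; split; first exact: openT.
      exists fset0; first by move=> ?; rewrite in_fset0.
      by rewrite set_fset0 bigcap_set0.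
    have -> : [set` b :: L'] = b |` [set` L'].
      by apply/seteqP; split=> c /=; rewrite inE => /predU1P.
    rewrite bigcap_setU1.
    have [|oL sL] := IHL; first by move=> c cL; apply: L'm; rewrite inE cL orbT.
    have bm : lt b m by apply: L'm; rewrite inE eqxx.
    split; first exact: openI.
    apply: finI_fromI => //; apply: (@finI_from1 _ _ _ id).
    rewrite /E; case: (pselect (lt a b)) => /= _; [right|left];
      by exists (f b) => //; exists b.
  have [_ _ _ _ mP] := fgood m.
  have /existsNP[y /not_implyP[By nVy]] : ~ B `<=` closure (V m).
    by apply: mP => //; exists x.
  exists y => b bL; have [->|bm] := eqVneq b m.
    by rewrite /E; case: (pselect (lt a m)).
  by apply: By; rewrite /= mem_filter bm.
have /choice[x xP] a : exists x, forall b, closure (E a b) x.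
  have [|l _|x xP] := @compact_fip X W setT (fun b => closure (E a b)) cX.
  - by move=> b _; exact: closed_closure.
  - have [g gP] := bdd [set` l] (finite_set_countable (finite_seq l)).
    have [x xP] := E_fip a g l gP.
    by exists x => b /xP; exact: subset_closure.
  - by exists x => b; exact: xP.
apply: (@no_free_sequence W lt ltW X x (fun a => closure (O a)) V) => //.
- by move=> a; have [] := fgood a.
- move=> a; have [_ _ _ + _] := fgood a.
  by apply: subset_trans; rewrite -(closure_id _).1 //; exact: closed_closure.
- by move=> a b nba; have := xP b a; rewrite /E; case: (pselect (lt b a)).
(* [x b] is only in the closure of the complement of [closure (V a)]; as [V a] is open, this still
   keeps it out of [V a]. *)
- move=> a b ba Vx; have := xP b a; rewrite /E.
  case: (pselect (lt b a)) => //= _.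
  have [oV _ _ _ _] := fgood a.
  move=> /(_ (V a) (open_nbhs_nbhs (conj oV Vx)))[y [+ Vy]].
  by apply; exact: subset_closure.
Qed.

End countably_tight_compact.

Lemma preimage_closure_sub {X Y : topologicalType} {f : X -> Y} {A : set Y} :
  continuous f -> closure (f @^-1` A) `<=` f @^-1` closure A.
Proof.
move=> cf x clx V /cf Vx; have [y [Ay Vy]] := clx _ Vx.
by exists (f y); split.
Qed.

(** * Covering by continuum many G_delta sets *)

Section picking.
Context {X : topologicalType} (x0 : X) (U : X -> nat -> set X).
Hypothesis cX : compact [set: X].
Hypothesis tX : countably_tight X.
Hypothesis oU : forall x n, open (U x n).
Hypothesis Ux : forall x n, U x n x.
Hypothesis UU : forall x n, closure (U x n.+1) `<=` U x n.

Definition trace (s : nat -> X) (x : X) : set (nat * nat) :=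
  [set z | U x z.1 (s z.2)].

(** One representative per trace: a fixed [s] thus needs only continuum many points. *)
Definition witness (s : nat -> X) (c : set (nat * nat)) : X :=
  xget x0 [set x | trace s x = c].

(* Since [closure (U x n.+1) `<=` U x n], the trace of the sequence [U x] on
   [range s] determines [\bigcap_n U x n `&` closure (range s)]. *)
Lemma witness_cover (s : nat -> X) (y : X) : closure (range s) y ->
  forall n, U (witness s (trace s y)) n y.
Proof.
move=> sy n; apply: UU => V Vy.
have wE : trace s (witness s (trace s y)) = trace s y.
  exact: (@xgetI _ x0 [set x | trace s x = trace s y] y erefl).
have yU := open_nbhs_nbhs (conj (oU y n.+1) (Ux y n.+1)).
have [_ [[k _ <-] [Vs ys]]] := sy _ (filterI Vy yU).
exists (s k); split=> //.
by have : trace s (witness s (trace s y)) (n.+1, k) by rewrite wE.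
Qed.

Local Notation picks :=
  (tree (nat * nat) (seq (set (nat * nat) * nat))).

Definition avoids (l : seq (set (nat * nat) * nat)) (s : nat -> nat -> X)
    (y : X) :=
  forall k, (k < size l)%N ->
    ~ U (witness (s k) (nth (set0, 0%N) l k).1) (nth (set0, 0%N) l k).2 y.

(* The values of [pick] form a set that has, for any finitely many sets
   [U (witness s c) n] with [s] a sequence in it, a point outside their union
   unless they cover [X]. *)
Fixpoint pick (t : picks) : X :=
  if t isn't Node l f then x0 else
  xget x0 (avoids l (fun k n => pick (f (k, n)))).

(** If [q] is missed, compactness gives [x] in the closure of the picks and outside every named
    neighbourhood that misses [q]. By tightness [x] is in the closure of a sequence of picks, whose
    witness for [x] has all its neighbourhoods around [x], although one of them misses [q]. *)
Lemma picks_cover (q : X) : exists (t : nat -> picks) (c : set (nat * nat)),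
  forall n, U (witness (pick \o t) c) n q.
Proof.
apply: contrapT => nq.
pose I : choiceType := {classic ((nat -> picks) * set (nat * nat) * nat)}.
pose V (i : I) := U (witness (pick \o i.1.1) i.1.2) i.2.
(* [None] indexes the extra closed set [closure (range pick)]. *)
pose oi : choiceType := option I.
pose K (j : oi) := if j is Some i then ~` V i else closure (range pick).
have [||x xK] := @compact_fip X oi
  [set j | if j is Some i then ~ V i q else True] K cX.
- by case=> [i|] _; [apply: open_closedC; exact: oU|exact: closed_closure].
- move=> l lD; pose l' := pmap id l.
  have l'E i : (i \in l') = (Some i \in l) by rewrite mem_pmap map_id.
  pose i0 : I := (fun=> Leaf, set0, 0%N).
  pose lab := [seq (i.1.2, i.2) | i : I <- l'].
  pose c (z : nat * nat) := (nth i0 l' z.1).1.1 z.2.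
  (* [q] itself avoids these sets, so the choice made at this node does too. *)
  have : avoids lab (fun k n => pick (c (k, n))) (pick (Node lab c)).
    apply: (@xgetI _ _ _ q) => k; rewrite size_map => kl.
    rewrite (nth_map i0) //= => Vq.
    by have := lD (Some (nth i0 l' k)); rewrite -l'E mem_nth //; apply.
  move=> labP; exists (pick (Node lab c)) => -[i|] il; last first.
    by apply: subset_closure; exists (Node lab c).
  have := labP (index i l'); rewrite size_map index_mem l'E => /(_ il).
  rewrite (nth_map i0) ?index_mem ?l'E // /c /=.
  by rewrite nth_index ?l'E.
have [B [Bp cB clB]] := tX _ _ (xK None Logic.I).
have [e [Be eB]] := @countable_sub_range _ (pick Leaf) _ cB.
have /choice[t te] n : exists t, pick t = e n.
  by have [->|/Bp[t _ <-]] := eB (e n) (ex_intro2 _ _ n Logic.I erefl);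
    [exists Leaf|exists t].
have xcl : closure (range (pick \o t)) x.
  by apply: closureS clB => _ /Be[n _ <-]; exists n => //=.
have xw := witness_cover _ _ xcl.
apply: nq; exists t, (trace (pick \o t) x) => n; apply: contrapT => nVq.
exact: (xK (Some (t, trace (pick \o t) x, n)) nVq).
Qed.

End picking.

Theorem theorem3p2 (X : topologicalType)
  (Xcompact : compact [set: X]) (Xhausdorff : hausdorff_space X)
  (Xhomogeneous : homogeneous X) (Xtight : countably_tight X) :
  ([set: X] #<= [set: set nat])%card.
Proof.
have [[p0 _]|noX] := pselect (exists x : X, True); last first.
  apply/pcard_injP; exists (fun=> set0) => x.
  by exfalso; apply: noX; exists x.
have [p [U [s [oU Up UU Us]]]] :=
  ex_gdelta_sub_closure_countable Xcompact Xhausdorff Xtight p0.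
have /choice[h /choice[g hgP]] x : exists (h g : X -> X),
    [/\ continuous h, continuous g, cancel h g, cancel g h & h p = x].
  by have [h [[ch [g [cg hK gK]]] hp]] := Xhomogeneous p x; exists h, g.
pose V x n := g x @^-1` U n.
have gx x : g x x = p by have [_ _ hK _ hp] := hgP x; rewrite -{2}hp hK.
have oV x n : open (V x n).
  by have [_ /continuousP cg _ _ _] := hgP x; exact: cg.
have Vx x n : V x n x by rewrite /V /= gx.
have VV x n : closure (V x n.+1) `<=` V x n.
  have [_ cg _ _ _] := hgP x.
  by apply: subset_trans (preimage_closure_sub cg) _ => y; exact: UU.
pose picks := tree (nat * nat) (seq (set (nat * nat) * nat)).
pose I := ((nat -> picks) * set (nat * nat) * nat)%type.
(* The sequence [s], carried to each witness: its closure there contains the translated G_delta set,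
   and these sets cover [X]. *)
pose D (i : I) := h (witness p V (pick p V \o i.1.1) i.1.2) (s i.2).
have denseD (O : set X) : open O -> O !=set0 -> exists i, O (D i).
  move=> oO [q Oq].
  have [t [c tc]] := picks_cover p V Xcompact Xtight oV Vx VV q.
  pose w := witness p V (pick p V \o t) c.
  have [ch cg hK gK _] := hgP w.
  have /Us : (\bigcap_n U n) (g w q) by move=> n _; exact: tc.
  move=> /(_ (h w @^-1` O))[|_ [[n _ <-] On]].
    by apply: ch; rewrite gK; exact: open_nbhs_nbhs.
  by exists (t, c, n).
have [B [oB B0 Bp]] := countable_local_pi_base Xcompact Xhausdorff Xtight p.
have /choice[F FP] q : exists F : nat -> I, forall n, B n (g q (D (F n))).
  suff /choice[F FP] : forall n, exists i, B n (g q (D i)) by exists F.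
  move=> n.
  have [_ cg hK _ _] := hgP q.
  apply: (denseD (g q @^-1` B n)); first by move/continuousP: cg; exact.
  by have [y By] := B0 n; exists (h q y); rewrite /= hK.
apply: (@continuum_inj _ _ F); last first.
  apply: continuum_fun; apply: continuum_prod; last exact: continuum_count.
  apply: continuum_prod; last exact: continuum_set.
  apply: continuum_fun; apply: continuum_tree; apply: continuum_seq.
  by apply: continuum_prod; [exact: continuum_set|exact: continuum_count].
(* Some [B n] is carried by [h q] into [P] and by [h r] into [Q], so the point of index
   [F q n = F r n] would lie in both. *)
move=> q r FE; apply: contrapT => /eqP qr.
have := Xhausdorff; rewrite open_hausdorff => /(_ q r qr)[[P Q]] /= [].
rewrite !inE => Pq Qr [oP oQ PQ0].
have [chq cgq hqK gqK hqp] := hgP q; have [chr cgr hrK grK hrp] := hgP r.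
have [||n BP] := Bp (h q @^-1` P `&` h r @^-1` Q).
- by apply: openI; [move/continuousP: chq; exact|move/continuousP: chr; exact].
- by split; rewrite /= ?hqp ?hrp.
have [Pn _] := BP _ (FP q n); have [_ Qn] := BP _ (FP r n).
by suff : set0 (D (F q n)) by []; rewrite -PQ0; split;
  [move: Pn; rewrite /= gqK|move: Qn; rewrite /= grK FE].
Qed.
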